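(* Let $X$ be a topological space with a nonnegative, $\sigma$-finite Borel measure $\mu$, and let $X\times X\supset U_0\supset U_1\supset U_2\supset\cdots$ be a nested sequence of open sets with $\bigcap_j U_j$ equal to the diagonal of $X\times X$; write $U_j(x):=\{y:(x,y)\in U_j\}$ and $U_j^*(y):=\{x:(x,y)\in U_j\}$, and assume these sets have finite, positive $\mu$-measure. Let $p\in[1,\infty)$, and let $\psi$ be a nonnegative, nondecreasing function on $[0,\infty)$ with $\psi(0)>0$ and $\lim_{t\to\infty}\psi(t)=\infty$. Suppose there are a nonnegative, nondecreasing function $\tilde\psi$ on $[0,\infty)$ and a constant $C_0$ such that $$\psi(xy)\le C_0\left(\psi(x)+\tilde\psi(y)\right)\quad\text{for all }x,y\ge0.$$ Let $W,W_+$ be nonnegative measurable weights on $X$, and let $\mathcal F$ be a class of measurable functions on $X$ such that, for some constant $C_1$, every $f\in\mathcal F$ satisfies $$\int_X|f|^pW_+\,d\mu\le C_1\int_X\left[\frac1{\mu(U_0(x))}\int_{U_0(x)}|f(x)-f(y)|^p\,d\mu(y)\right]W(x)\,d\mu(x).$$ Suppose there are constants $C_2,C_3$ such that for all $x\in X$ and all $j\ge0$ $$W(x)\left[\psi\left([\mu(U_0^*(x))]^{-1/p}\right)+\tilde\psi\left([W(x)]^{-1/p}\right)\right]\le C_2\,W_+(x),$$ $$W(x)\le\frac{C_3}{\mu(U_j^*(x))}\int_{U_j^*(x)}W(y)\,d\mu(y).$$ Then there is a constant $c>0$ such that for every $f\in\mathcal F$ with $0<\|f\|_{p,\psi}<\infty$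 (the quantity $\|f\|_{p,\psi}$ being defined in the context), $$\int_X\psi\left(\frac{c|f(y)|}{\|f\|_{p,\psi}}\right)\left|\frac{c|f(y)|}{\|f\|_{p,\psi}}\right|^pW(y)\,d\mu(y)\le1 .$$ The constant $c$ does not depend on $f$.
   Context: For $(x,y)\in U_0$, $\mathrm{VOL}^*(x,y)$ is the infimum of $\mu(U_{j+1}^*(y))$ over all $j\ge0$ such that $x\in U_j^*(y)$ (it is undefined if $y\notin U_0(x)$). Define $$K_{p,\psi}(x,y):=\frac{\psi\left([\mathrm{VOL}^*(x,y)]^{-1/p}\right)}{\mathrm{VOL}^*(x,y)}+\frac1{\mu(U_0(x))},$$ $$\|f\|_{p,\psi}^p:=\int_X\left(\int_{U_0(x)}|f(x)-f(y)|^pK_{p,\psi}(x,y)\,d\mu(y)\right)W(x)\,d\mu(x).$$ On the diagonal $x=y$ the integrand $|f(x)-f(y)|^pK_{p,\psi}(x,y)$ is taken to be $0$ (even if $\mathrm{VOL}^*(x,x)=0$). At points where $W(x)=0$ the left-hand side of the inequality involving $\tilde\psi([W(x)]^{-1/p})$ is taken to be $0$. The pair $(W,W_+)$ is not assumed to satisfy any further relation.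
   Formalization: It is additionally assumed that for each f in the class the integrand |f(x)-f(y)|^p K(x,y) on U_0 is measurable for the product of the Borel sigma-algebras (automatic if X is second countable); without this Tonelli, and the claim, can fail on general topological spaces. *)

(* Defs.v *)
(* MathComp-Analysis *)
From mathcomp Require Import all_boot all_order all_algebra.
From mathcomp Require Import all_classical all_reals all_analysis.

Set Implicit Arguments.
Unset Strict Implicit.
Unset Printing Implicit Defensive.

Import Order.TTheory GRing.Theory Num.Theory.
Import numFieldNormedType.Exports.
Local Open Scope classical_set_scope.
Local Open Scope ring_scope.

(* X with its Borel sigma-algebra. Every [measurableType] is pointed, which
   is why X is a [ptopologicalType]. *)
Notation borel X := (g_sigma_algebraType (@open X)).

(* Throughout, U_j(x) is [xsection (U j) x] and U_j^*(y) is
   [ysection (U j) y]. *)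

(* Equal to +oo when (x, y) is not in U_0, where VOL^* is undefined. *)
Definition vol_star (R : realType) (X : ptopologicalType)
    (mu : {measure set (borel X) -> \bar R}) (U : nat -> set (X * X))
    (x y : X) : \bar R :=
  ereal_inf [set mu (ysection (U j.+1) y) | j in [set j | ysection (U j) y x]].

(* For distinct x, y with (x, y) in U_0, [vol_star] is finite and positive as
   soon as the U_j^*(y) have finite positive measure and the U_j shrink to the
   diagonal. On the diagonal [vol_star] may vanish; the value given here (from
   0 `^ (- p^-1) = 0 and 0^-1 = 0) is then junk, but it is only ever
   multiplied by `|f x - f x| `^ p = 0. *)
Definition kernel (R : realType) (X : ptopologicalType)
    (mu : {measure set (borel X) -> \bar R}) (U : nat -> set (X * X))
    (p : R) (psi : R -> R) (x y : X) : R :=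
  psi (fine (vol_star mu U x y) `^ (- p^-1)) / fine (vol_star mu U x y)
  + (fine (mu (xsection (U 0%N) x)))^-1.

Definition integrand (R : realType) (X : ptopologicalType)
    (mu : {measure set (borel X) -> \bar R}) (U : nat -> set (X * X))
    (p : R) (psi : R -> R) (f : X -> R) (x y : X) : R :=
  `|f x - f y| `^ p * kernel mu U p psi x y.

Definition seminorm (R : realType) (X : ptopologicalType)
    (mu : {measure set (borel X) -> \bar R}) (U : nat -> set (X * X))
    (p : R) (psi : R -> R) (W f : X -> R) : \bar R :=
  ((\int[mu]_x
      ((\int[mu]_(y in xsection (U 0%N) x) (integrand mu U p psi f x y)%:E)
       * (W x)%:E)) `^ p^-1)%E.

(* Main.v *)
(* Write V_j = mu(U_j^*(y)) and let N be the seminorm of f. For each y and j,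
   the mean value condition on W and |f(y)| <= |f(x)| + |f(x) - f(y)| show that
   W(y) V_j |f(y)|^p is bounded by a constant times the integral over U_j^*(y)
   either of |f|^p W ("good" j) or of |f(x) - f(y)|^p W(x) ("bad" j).
   - If j is good, the Poincare inequality gives W(y) V_j |f(y)|^p <= C N^p, so
     that c |f(y)| / N <= V_j^(-1/p) W(y)^(-1/p) and the growth condition bounds
     psi(c |f(y)| / N) by psi(V_j^(-1/p)) + psit(W(y)^(-1/p)) up to a constant.
   - If j is bad, K(x, y) >= psi(V_(j+1)^(-1/p)) / V_(j+1) on U_j^*(y) gives
     |f(y)|^p psi(V_(j+1)^(-1/p)) W(y) <= C Xi(y), where Xi(y) is the integral
     of |f(x) - f(y)|^p K(x, y) W(x) over x in U_0^*(y).
   Both apply at the least good j and its predecessor; the level j = 0 is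
   controlled by W_+ instead of Xi. If every j is bad then Xi(y) = +oo, because
   otherwise the integrals over U_j^*(y), which shrinks to {y}, would tend to 0.
   Integrating the resulting bound in y, the integral of Xi is N^p by Tonelli. *)
Require Import Defs.
From mathcomp Require Import all_boot all_order all_algebra.
From mathcomp Require Import all_classical all_reals all_analysis.
From mathcomp Require Import measurable_realfun.
From mathcomp Require Import ring.

Set Implicit Arguments.
Unset Strict Implicit.
Unset Printing Implicit Defensive.

Import Order.TTheory GRing.Theory Num.Theory.
Import numFieldNormedType.Exports.
Local Open Scope classical_set_scope.
Local Open Scope ring_scope.

(** * Comparison and convergence of integrals *)

(** The integral of a nonnegative function is a supremum over the simple functions below it, and
    those below [f] are below [g]. This form applies to iterated integrals whose inner part is not
    known to be measurable in the outer variable. *)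
Lemma ge0_le_integral_nomeas d (T : measurableType d) (R : realType)
    (mu : {measure set T -> \bar R}) (D : set T) (f g : T -> \bar R) :
  (forall x, D x -> (0 <= f x)%E) -> (forall x, D x -> (f x <= g x)%E) ->
  (\int[mu]_(x in D) f x <= \int[mu]_(x in D) g x)%E.
Proof.
move=> f0 fg; have g0 x : D x -> (0 <= g x)%E.
  by move=> Dx; rewrite (le_trans (f0 _ Dx))// fg.
rewrite !ge0_integralE//; apply: ereal_sup_le => _ [h /= hf <-]; exists h => //.
move=> x; rewrite (le_trans (hf x))// /patch.
by case: ifPn => // /set_mem; exact: fg.
Qed.

(** Dominated convergence with majorant [h]. Asking [h] to vanish on the intersection, rather than
    the intersection to be null, allows for points of positive measure. *)
Lemma cvg_integral_decreasing d (T : measurableType d) (R : realType)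
    (mu : {measure set T -> \bar R}) (A : nat -> set T) (h : T -> R) :
  (forall n, measurable (A n)) -> nonincreasing_seq A ->
  measurable_fun [set: T] h -> (forall x, 0 <= h x) ->
  (\int[mu]_x (h x)%:E < +oo)%E ->
  (forall x, (forall n, A n x) -> h x = 0) ->
  (\int[mu]_(x in A n) (h x)%:E)%E @[n --> \oo] --> 0%E.
Proof.
move=> mA ndA mh h0 hoo hA.
have mh' : measurable_fun [set: T] (fun x => (h x)%:E) by exact/measurable_EFinP.
have ih : mu.-integrable [set: T] (fun x => (h x)%:E).
  apply/integrableP; split => //.
  by under eq_integral do rewrite /= ger0_norm//.
have [] := @dominated_convergence _ _ _ mu setT measurableT
  (fun n => (EFin \o h) \_ (A n)) (cst 0%E) (fun x => (h x)%:E).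
- by move=> n; apply/(measurable_restrictT _ _).1 => //; apply: measurable_funTS.
- by [].
- apply: aeW => x _; have [Ax|/existsNP[n nAx]] := pselect (forall n, A n x).
    apply: cvg_near_cst; near=> n; rewrite /patch /= hA//.
    by case: ifP.
  apply: cvg_near_cst; exists n => // m /= nm; rewrite /patch memNset// => Amx.
  by apply: nAx; move: Amx; apply/subsetPset; exact: ndA.
- by [].
- apply: aeW => x n _; rewrite /patch /=; case: ifP => _ /=.
    by rewrite ger0_norm.
  by rewrite normr0 lee_fin.
move=> _ _; rewrite integral0.
by under eq_fun do rewrite -integral_mkcond.
Unshelve. all: by end_near. Qed.

Lemma measurable_xsection_open (X : ptopologicalType) (A : set (X * X)) (x : X) :
  open A -> measurable (xsection A x : set (borel X)).
Proof.
move=> oA; apply: sub_sigma_algebra; rewrite xsectionE.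
by apply: open_comp => // y _; apply: cvg_pair => //; exact: cvg_cst.
Qed.

Lemma measurable_ysection_open (X : ptopologicalType) (A : set (X * X)) (y : X) :
  open A -> measurable (ysection A y : set (borel X)).
Proof.
move=> oA; apply: sub_sigma_algebra; rewrite ysectionE.
by apply: open_comp => // x _; apply: cvg_pair => //; exact: cvg_cst.
Qed.

(** * Dichotomy for means, and the growth condition *)

Lemma powRD_le_mul2 (R : realType) (p u v : R) : 0 <= p -> 0 <= u -> 0 <= v ->
  (u + v) `^ p <= 2 `^ p * (u `^ p + v `^ p).
Proof.
move=> p0; wlog uv : u v / u <= v => [H u0 v0|u0 v0].
  by have [/H->//|/ltW/H] := leP u v; rewrite addrC [X in _ * X]addrC => ->.
rewrite (@le_trans _ _ ((2 * v) `^ p))//.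
  apply: ge0_ler_powR => //; rewrite ?nnegrE ?addr_ge0 ?mulr_ge0//.
  by rewrite mulrDl mul1r lerD2r.
by rewrite powRM// ler_wpM2l ?powR_ge0// lerDr powR_ge0.
Qed.

(* By [|b| <= |f x| + |f x - b|], one of the two terms carries half of the
   average of [W] over [A]. *)
Lemma mean_dichotomy d (T : measurableType d) (R : realType)
    (mu : {measure set T -> \bar R}) (A : set T) (f W : T -> R)
    (p b w v C : R) :
  measurable A -> measurable_fun A f -> measurable_fun A W ->
  (forall x, 0 <= W x) -> 0 <= p -> 0 <= C ->
  ((w * v)%:E <= C%:E * \int[mu]_(x in A) (W x)%:E)%E ->
  let B := 2 * 2 `^ p * C in
  ((w * v * `|b| `^ p)%:E <= B%:E * \int[mu]_(x in A) (`|f x| `^ p * W x)%:E)%E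
  \/ ((w * v * `|b| `^ p)%:E
      <= B%:E * \int[mu]_(x in A) (`|f x - b| `^ p * W x)%:E)%E.
Proof.
move=> mA mf mW W0 p0 C0 wvC B.
have mpow (g : T -> R) : measurable_fun A g ->
    measurable_fun A (fun x => (`|g x| `^ p * W x)%:E).
  move=> mg; apply/measurable_EFinP; apply: measurable_funM => //.
  apply: (measurableT_comp (measurable_powR p)).
  exact: measurableT_comp.
have mfb : measurable_fun A (fun x => f x - b) by exact: measurable_funB.
set I1 := (\int[mu]_(x in A) (`|f x| `^ p * W x)%:E)%E.
set I2 := (\int[mu]_(x in A) (`|f x - b| `^ p * W x)%:E)%E.
have I10 : (0 <= I1)%E.
  by apply: integral_ge0 => x _; rewrite lee_fin mulr_ge0// powR_ge0.
have I20 : (0 <= I2)%E.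
  by apply: integral_ge0 => x _; rewrite lee_fin mulr_ge0// powR_ge0.
have H : ((w * v * `|b| `^ p)%:E <= (2 `^ p * C)%:E * (I1 + I2))%E.
  rewrite mulrC EFinM (le_trans (lee_wpmul2l _ wvC)) ?lee_fin ?powR_ge0//.
  rewrite muleA -EFinM mulrC EFinM -muleA.
  rewrite [(2 `^ p * C)]mulrC EFinM -muleA lee_wpmul2l ?lee_fin//.
  rewrite -ge0_integralZl ?lee_fin ?powR_ge0//; last 2 first.
  - exact/measurable_EFinP.
  - by move=> x _; rewrite lee_fin.
  rewrite /I1 /I2 -ge0_integralD//; last 4 first.
  - by move=> x _; rewrite lee_fin mulr_ge0// powR_ge0.
  - exact: mpow.
  - by move=> x _; rewrite lee_fin mulr_ge0// powR_ge0.
  - exact: mpow.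
  rewrite -ge0_integralZl ?lee_fin ?powR_ge0//; last 2 first.
  - by apply: emeasurable_funD; exact: mpow.
  - by move=> x _; rewrite adde_ge0// lee_fin mulr_ge0// powR_ge0.
  apply: ge0_le_integral_nomeas => x _.
    by rewrite -EFinM lee_fin mulr_ge0// powR_ge0.
  rewrite -EFinM -EFinD -EFinM lee_fin -mulrDl mulrA ler_wpM2r//.
  rewrite (le_trans _ (powRD_le_mul2 p0 _ _))//.
  apply: ge0_ler_powR => //; rewrite ?nnegrE ?addr_ge0//.
  by rewrite -[X in `|X| <= _](subKr (f x)) (le_trans (ler_normB _ _)).
have Bmul (I : \bar R) : (B%:E * I = (2 `^ p * C)%:E * (2%:E * I))%E.
  by rewrite muleA -EFinM [(_ * _ * 2)%R]mulrC mulrA.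
have B'0 : (0 <= (2 `^ p * C)%:E)%E by rewrite lee_fin mulr_ge0// powR_ge0.
have dbl (I : \bar R) : (2%:E * I = I + I)%E by rewrite -mule2n muleC mule_natr.
(* Source of the factor 2 in [B]: the sum is at most twice the larger integral. *)
have half (I : \bar R) : (I1 + I2 <= I + I)%E ->
    ((w * v * `|b| `^ p)%:E <= B%:E * I)%E.
  by move=> I12; rewrite Bmul dbl; apply: le_trans H _; exact: lee_wpmul2l.
have [I12|/ltW I21] := leP I1 I2; [right|left]; apply: half.
- exact: leeD2r.
- exact: leeD2l.
Qed.

(** The last hypothesis amounts to s <= v^(-1/p) w^(-1/p), so monotonicity of [psi] reduces the
    claim to [psi_mul] at these two factors. *)
Lemma growth_le (R : realType) (p C0 : R) (psi psit : R -> R)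
    (psi_nd : forall s t : R, 0 <= s -> s <= t -> psi s <= psi t)
    (psi_mul : forall x y : R, 0 <= x -> 0 <= y ->
       psi (x * y) <= C0 * (psi x + psit y)) (s v w : R) :
  0 < p -> 0 <= s -> 0 < v -> 0 < w -> s `^ p * (v * w) <= 1 ->
  psi s <= C0 * (psi (v `^ (- p^-1)) + psit (w `^ (- p^-1))).
Proof.
move=> p0 s0 v0 w0 svw; rewrite (le_trans _ (psi_mul _ _ _ _)) ?powR_ge0//.
apply: psi_nd => //; rewrite -powRM ?(ltW v0) ?(ltW w0)// powRN.
rewrite -[s]powRr1// -(mulfV (lt0r_neq0 p0)) powRrM.
have vw : 0 < v * w by rewrite mulr_gt0.
rewrite -[leRHS]mul1r ler_pdivlMr ?powR_gt0//.
rewrite -powRM ?powR_ge0 ?(ltW vw)//.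
have /ge0_ler_powR h : 0 <= p^-1 by rewrite invr_ge0 ltW.
have := h _ 1 _ _ svw; rewrite powR1; apply; rewrite nnegrE//.
by rewrite mulr_ge0 ?powR_ge0// ltW.
Qed.

(** * Lower bounds for the kernel *)

Section kernel_bounds.
Context (R : realType) (X : ptopologicalType)
  (mu : {measure set (borel X) -> \bar R}) (U : nat -> set (X * X)).

Lemma vol_star_ge0 (x y : X) : (0 <= vol_star mu U x y)%E.
Proof. by apply: le_ereal_inf_tmp => _ [j _ <-]. Qed.

(** Through this bound the p-th power of the seminorm dominates the double integral in the Poincare
    inequality. *)
Lemma kernel_ge_inv (p : R) (psi : R -> R) (x y : X) :
  (forall t, 0 <= t -> 0 <= psi t) ->
  (fine (mu (xsection (U 0%N) x)))^-1 <= Defs.kernel mu U p psi x y.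
Proof.
move=> psi_ge0; rewrite /Defs.kernel lerDr divr_ge0 ?psi_ge0 ?powR_ge0//.
by rewrite fine_ge0// vol_star_ge0.
Qed.

Lemma integrand_ge0 (p : R) (psi f : _ -> R) (x y : X) :
  (forall t, 0 <= t -> 0 <= psi t) -> 0 <= integrand mu U p psi f x y.
Proof.
move=> psi_ge0; rewrite mulr_ge0 ?powR_ge0//.
by rewrite (le_trans _ (kernel_ge_inv _ _ _ _))// invr_ge0 fine_ge0.
Qed.

Hypothesis U_open : forall j, open (U j).
Hypothesis U_nested : forall j, U j.+1 `<=` U j.
Hypothesis U_diag : \bigcap_j U j = diagonal.
Hypothesis U_star : forall j y, (0 < mu (ysection (U j) y) < +oo)%E.

Lemma U_decreasing m n : (m <= n)%N -> U n `<=` U m.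
Proof.
move=> /subnK <-; elim: (n - m)%N => [//|k IH]; rewrite addSn.
by move=> z /U_nested/IH.
Qed.

Lemma star_gt0 j y : 0 < fine (mu (ysection (U j) y)).
Proof. exact: fine_gt0. Qed.

Lemma star_fin j y :
  mu (ysection (U j) y) = (fine (mu (ysection (U j) y)))%:E.
Proof.
by rewrite fineK// fin_numElt; have /andP[/ltW h ->] := U_star j y;
  rewrite (lt_le_trans _ h).
Qed.

Lemma star_decreasing j y :
  fine (mu (ysection (U j.+1) y)) <= fine (mu (ysection (U j) y)).
Proof.
rewrite -lee_fin -!star_fin; apply: le_measure; rewrite ?inE.
- exact: measurable_ysection_open.
- exact: measurable_ysection_open.
- by apply: le_ysection; exact: U_nested.
Qed.

(* Off the diagonal, [x] leaves some [U_J^*(y)], so that the infimum defining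
   [vol_star] is at least [mu (U_J^*(y)) > 0] and no junk value occurs. *)
Lemma vol_star_bounds (x y : X) (j : nat) : x <> y -> ysection (U j) y x ->
  0 < fine (vol_star mu U x y) <= fine (mu (ysection (U j.+1) y)).
Proof.
move=> xy Ujx.
have vle : (vol_star mu U x y <= mu (ysection (U j.+1) y))%E.
  by apply: ereal_inf_lbound; exists j.
have [J UJ] : exists J, ~ U J (x, y).
  apply/existsNP => Uall; apply: xy.
  by have : (\bigcap_j U j) (x, y) by []; rewrite U_diag.
have vge : (mu (ysection (U J) y) <= vol_star mu U x y)%E.
  apply: le_ereal_inf_tmp => _ [i /= /ysectionP Ui <-].
  apply: le_measure; rewrite ?inE; [exact: measurable_ysection_open..|].
  apply: le_ysection; apply: U_decreasing.
  by rewrite ltnNge; apply/negP => Ji; apply: UJ; exact: U_decreasing Ui.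
have /andP[UJ0 _] := U_star J y; have /andP[_ Ujoo] := U_star j.+1 y.
have v0 := lt_le_trans UJ0 vge; have voo := le_lt_trans vle Ujoo.
rewrite fine_gt0 ?v0//= -lee_fin -star_fin fineK//.
by rewrite fin_numElt voo (lt_trans _ v0).
Qed.

(** The function psi(t^(-1/p)) / t is nonincreasing in t > 0, and [vol_star] is at most the volume
    at level [j.+1]. On the diagonal both sides are 0, whatever the junk value of the kernel. *)
Lemma integrand_ge (p : R) (psi f : _ -> R) (x y : X) (j : nat) : 1 <= p ->
  (forall t, 0 <= t -> 0 <= psi t) ->
  (forall s t, 0 <= s -> s <= t -> psi s <= psi t) ->
  ysection (U j) y x ->
  `|f x - f y| `^ p * (psi (fine (mu (ysection (U j.+1) y)) `^ (- p^-1))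
                       / fine (mu (ysection (U j.+1) y)))
  <= integrand mu U p psi f x y.
Proof.
move=> p1 psi_ge0 psi_nd Ux; set v := fine _.
have p0 : 0 < p by rewrite (lt_le_trans _ p1).
have [->|/eqP xy] := eqVneq x y.
  rewrite /integrand subrr normr0 powR0 ?lt0r_neq0// !mul0r.
  exact: lexx.
rewrite ler_wpM2l ?powR_ge0// /Defs.kernel.
have /andP[w0 wv] := vol_star_bounds xy Ux.
set w := fine (vol_star _ _ _ _) in w0 wv *.
have v0 : 0 < v := lt_le_trans w0 wv.
rewrite -[leLHS]addr0 lerD ?invr_ge0 ?fine_ge0//.
apply: ler_pM; rewrite ?invr_ge0 ?psi_ge0 ?powR_ge0 ?(ltW v0)//.
- apply: psi_nd; rewrite ?powR_ge0// !powRN lef_pV2 ?posrE ?powR_gt0//.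
  by apply: ge0_ler_powR; rewrite ?nnegrE ?invr_ge0 ?(ltW v0) ?(ltW w0) ?(ltW p0).
- by rewrite lef_pV2.
Qed.

End kernel_bounds.

Theorem theorem2 (R : realType) (X : ptopologicalType)
  (mu : {sigma_finite_measure set (borel X) -> \bar R})
  (U : nat -> set (X * X))
  (U_open : forall j, open (U j))
  (U_nested : forall j, U j.+1 `<=` U j)
  (U_diag : \bigcap_j U j = diagonal)
  (U_sect : forall j x, (0 < mu (xsection (U j) x) < +oo)%E)
  (U_star : forall j y, (0 < mu (ysection (U j) y) < +oo)%E)
  (p : R) (p_ge1 : 1 <= p)
  (psi : R -> R)
  (psi_ge0 : forall t : R, 0 <= t -> 0 <= psi t)
  (psi_nd : forall s t : R, 0 <= s -> s <= t -> psi s <= psi t)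
  (psi0 : 0 < psi 0)
  (psi_lim : psi t @[t --> +oo] --> +oo)
  (psit : R -> R) (C0 : R)
  (psit_ge0 : forall t : R, 0 <= t -> 0 <= psit t)
  (psit_nd : forall s t : R, 0 <= s -> s <= t -> psit s <= psit t)
  (psi_mul : forall x y : R, 0 <= x -> 0 <= y ->
     psi (x * y) <= C0 * (psi x + psit y))
  (W Wp : X -> R)
  (W_ge0 : forall x, 0 <= W x)
  (Wp_ge0 : forall x, 0 <= Wp x)
  (W_meas : measurable_fun [set: borel X] W)
  (Wp_meas : measurable_fun [set: borel X] Wp)
  (F : set (X -> R))
  (F_meas : forall f, F f -> measurable_fun [set: borel X] f)
  (* The integrand of the iterated integral defining the seminorm is
     measurable for the product of the Borel sigma-algebras. *)
  (F_integrand : forall f, F f ->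
     measurable_fun [set: borel X * borel X]
       (fun z : X * X => \1_(U 0%N) z * integrand mu U p psi f z.1 z.2))
  (C1 : R)
  (F_poincare : forall f, F f ->
     (\int[mu]_x (`|f x| `^ p * Wp x)%:E
      <= C1%:E *
         \int[mu]_x
           (((fine (mu (xsection (U 0%N) x)))^-1%:E *
             \int[mu]_(y in xsection (U 0%N) x) (`|f x - f y| `^ p)%:E)
            * (W x)%:E))%E)
  (C2 C3 : R)
  (W_Wp : forall x,
     W x * (psi (fine (mu (ysection (U 0%N) x)) `^ (- p^-1))
            + psit (W x `^ (- p^-1)))
     <= C2 * Wp x)
  (W_mean : forall x j,
     ((W x)%:E <= (C3 / fine (mu (ysection (U j) x)))%:E
                  * \int[mu]_(y in ysection (U j) x) (W y)%:E)%E) :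
  exists2 c : R, 0 < c &
    forall f, F f ->
      (0 < seminorm mu U p psi W f < +oo)%E ->
      let g y := c * `|f y| / fine (seminorm mu U p psi W f) in
      (\int[mu]_y (psi (g y) * `|g y| `^ p * W y)%:E <= 1)%E.

Proof.

(* Positive constants and normalized hypotheses *)
have p0 : 0 < p := lt_le_trans ltr01 p_ge1.
(* The given constants may have any sign; these are positive and still valid, since they multiply
   nonnegative quantities. *)
pose c0 : R := `|C0| + 1; pose c1 : R := `|C1| + 1.
pose c2 : R := `|C2| + 1; pose c3 : R := `|C3| + 1.
have c0_gt0 : 0 < c0 by rewrite ltr_wpDl.
have c1_gt0 : 0 < c1 by rewrite ltr_wpDl.
have c2_gt0 : 0 < c2 by rewrite ltr_wpDl.
have c3_gt0 : 0 < c3 by rewrite ltr_wpDl.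
have le_absD1 (C : R) : C <= `|C| + 1.
  by rewrite (le_trans (ler_norm _))// lerDl.
have psi_mul' x y : 0 <= x -> 0 <= y -> psi (x * y) <= c0 * (psi x + psit y).
  move=> x0 y0; rewrite (le_trans (psi_mul _ _ x0 y0))// ler_wpM2r//.
  by rewrite addr_ge0 ?psi_ge0 ?psit_ge0.
pose V j y := fine (mu (ysection (U j) y)).
have V_gt0 j y : 0 < V j y by exact: star_gt0.
have W_Wp' x : W x * (psi (V 0%N x `^ (- p^-1)) + psit (W x `^ (- p^-1)))
    <= c2 * Wp x.
  by rewrite (le_trans (W_Wp x))// ler_wpM2r.
have W_mean' y j :
    ((W y * V j y)%:E <= c3%:E * \int[mu]_(x in ysection (U j) y) (W x)%:E)%E.
  have IW : (0 <= \int[mu]_(x in ysection (U j) y) (W x)%:E)%E.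
    by apply: integral_ge0 => x _; rewrite lee_fin.
  have V_ge0 : (0 <= (V j y)%:E)%E by rewrite lee_fin ltW.
  rewrite mulrC EFinM (le_trans (lee_wpmul2l V_ge0 (W_mean y j)))//.
  rewrite muleA -EFinM mulrC divfK ?(gt_eqF (V_gt0 _ _))// lee_wpmul2r// lee_fin.
  exact: le_absD1.
(* Drop the [psit] term and bound the [psi] term below by [psi 0], which is positive. *)
have W_le x : W x <= c2 / psi 0 * Wp x.
  rewrite mulrAC ler_pdivlMr// (le_trans _ (W_Wp' x))// ler_wpM2l//.
  rewrite -[leLHS]addr0 lerD ?psit_ge0 ?powR_ge0//.
  by apply: psi_nd; rewrite ?powR_ge0.
(* [M] will bound the integral of |f|^p W by M N^p; [B] is the constant of [mean_dichotomy] for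
   [c3]. *)
pose M := c2 / psi 0 * c1.
pose B := 2 * 2 `^ p * c3.
(* The constant is [c] with [c `^ p = A^-1]: the first summand of [A] makes the
   growth condition applicable, the second one bounds the final integral. *)
pose A := B * M + c0 * (c2 * c1 + B).
have M_gt0 : 0 < M by rewrite mulr_gt0 ?divr_gt0.
have B_gt0 : 0 < B by rewrite !mulr_gt0 ?powR_gt0.
have A_gt0 : 0 < A.
  apply: addr_gt0; first exact: mulr_gt0.
  by apply: mulr_gt0 => //; apply: addr_gt0 => //; exact: mulr_gt0.
exists (A `^ (- p^-1)); first by rewrite powR_gt0.

(* The function Xi and its integral *)
move=> f Ff /= sem; have mf := F_meas _ Ff.
set N := fine (seminorm _ _ _ _ _ _).
have N_gt0 : 0 < N by exact: fine_gt0.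
(* The indicator makes [H] a function on the whole product, as Tonelli requires: it restricts y to
   U_0(x) for fixed x, and x to U_0^*(y) for fixed y. *)
pose H (z : X * X) := \1_(U 0%N) z * integrand mu U p psi f z.1 z.2 * W z.1.
have mH : measurable_fun [set: borel X * borel X] (fun z => (H z)%:E).
  apply/measurable_EFinP; apply: measurable_funM; first exact: F_integrand _ Ff.
  exact: (measurableT_comp W_meas).
have H_ge0 z : 0 <= H z.
  apply: mulr_ge0 => //; apply: mulr_ge0 => //; exact: integrand_ge0.
pose Xi y := (\int[mu]_x (H (x, y))%:E)%E.
have Xi_ge0 y : (0 <= Xi y)%E.
  by apply: integral_ge0 => x _; rewrite lee_fin.
have mXi : measurable_fun [set: borel X] Xi.
  exact: (@measurable_fun_fubini_tonelli_G _ _ _ _ _ mu _ mH).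
have energyE : (\int[mu]_x
      ((\int[mu]_(y in xsection (U 0%N) x) (integrand mu U p psi f x y)%:E)
       * (W x)%:E) = (N `^ p)%:E)%E.
  have pV0 : p^-1 != 0 by rewrite invr_neq0// lt0r_neq0.
  move: sem; rewrite /N /seminorm; set I := (\int[mu]_x _)%E => /andP[_ Ioo].
  have I0 : (0 <= I)%E.
    apply: integral_ge0 => x _; rewrite mule_ge0 ?lee_fin//.
    by apply: integral_ge0 => y _; rewrite lee_fin integrand_ge0.
  (* The root is finite by [sem], hence so is the integral [I], and [fine] loses nothing. *)
  rewrite fine_poweR -powRrM mulVf ?lt0r_neq0// powRr1 ?fine_ge0// fineK//.
  by rewrite ge0_fin_numE// (lty_poweRy pV0).
have mUx x : measurable (xsection (U 0%N) x : set (borel X)).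
  exact: measurable_xsection_open.
have XiE : (\int[mu]_y Xi y = (N `^ p)%:E)%E.
  rewrite -energyE /Xi -(@fubini_tonelli _ _ _ _ _ mu mu _ mH)//.
  apply: eq_integral => x _; rewrite -ge0_integralZr ?lee_fin//; last 2 first.
  - have := measurable_fun_pair2 x (F_integrand _ Ff).
    move=> /(@measurable_funTS _ _ _ _ (xsection (U 0%N) x : set (borel X))) mfx.
    apply/measurable_EFinP; move: mfx; apply: eq_measurable_fun => y.
    by rewrite mem_xsection indicE => -> /=; rewrite mul1r.
  - by move=> y _; rewrite lee_fin integrand_ge0.
  rewrite [RHS]integral_mkcond; apply: eq_integral => y _.
  rewrite /H /patch mem_xsection indicE /=.
  by case: ifP => _; rewrite ?mul1r ?mul0r// EFinM.

(* Consequences of the Poincare inequality *)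
have poinc : (\int[mu]_x (`|f x| `^ p * Wp x)%:E <= (c1 * N `^ p)%:E)%E.
  apply: (le_trans (F_poincare _ Ff)).
  set J := (\int[mu]_x _)%E.
  have J0 : (0 <= J)%E.
    apply: integral_ge0 => x _; rewrite !mule_ge0 ?lee_fin ?invr_ge0 ?fine_ge0//.
    by apply: integral_ge0 => y _; rewrite lee_fin powR_ge0.
  apply: (@le_trans _ _ (c1%:E * J)%E).
    by rewrite lee_wpmul2r// lee_fin; exact: le_absD1.
  rewrite EFinM lee_wpmul2l ?lee_fin ?(ltW c1_gt0)// -energyE.
  apply: ge0_le_integral_nomeas => x _.
    rewrite !mule_ge0 ?lee_fin ?invr_ge0 ?fine_ge0//.
    by apply: integral_ge0 => y _; rewrite lee_fin powR_ge0.
  rewrite lee_wpmul2r ?lee_fin//.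
  rewrite -ge0_integralZl ?lee_fin ?invr_ge0 ?fine_ge0//; last first.
    apply/measurable_EFinP; apply: (measurableT_comp (measurable_powR p)).
    apply: measurableT_comp => //; apply: measurable_funB => //.
    exact: measurable_funTS.
  apply: ge0_le_integral_nomeas => y _.
    by rewrite -EFinM lee_fin mulr_ge0 ?powR_ge0// invr_ge0 fine_ge0.
  rewrite -EFinM lee_fin mulrC ler_wpM2l ?powR_ge0//.
  exact: kernel_ge_inv.
have mpow (h : X -> R) : measurable_fun [set: borel X] h ->
    measurable_fun [set: borel X] (fun x => (`|f x| `^ p * h x)%:E).
  move=> mh; apply/measurable_EFinP; apply: measurable_funM => //.
  apply: (measurableT_comp (measurable_powR p)).
  exact: measurableT_comp.
have fW : (\int[mu]_x (`|f x| `^ p * W x)%:E <= (M * N `^ p)%:E)%E.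
  have k0 : 0 <= c2 / psi 0 by rewrite divr_ge0 ?ltW.
  apply: (@le_trans _ _
    ((c2 / psi 0)%:E * \int[mu]_x (`|f x| `^ p * Wp x)%:E)%E); last first.
    by rewrite /M -(mulrA _ c1) [leRHS]EFinM lee_wpmul2l// lee_fin.
  rewrite -ge0_integralZl ?lee_fin//; last 2 first.
  - exact: mpow.
  - by move=> x _; rewrite lee_fin mulr_ge0 ?powR_ge0.
  apply: ge0_le_integral_nomeas => x _.
    by rewrite lee_fin mulr_ge0 ?powR_ge0.
  by rewrite -EFinM lee_fin mulrCA ler_wpM2l ?powR_ge0.
have k_gt0 : 0 < A^-1 / N `^ p * c0.
  by rewrite !mulr_gt0 ?invr_gt0 ?powR_gt0.

(* Pointwise bound of the integrand *)
have pt y : ((psi (A `^ (- p^-1) * `|f y| / N)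
              * `|A `^ (- p^-1) * `|f y| / N| `^ p * W y)%:E
    <= (A^-1 / N `^ p * c0)%:E
       * ((c2 * (`|f y| `^ p * Wp y))%:E + B%:E * Xi y))%E.
  set a := `|f y| `^ p; set s := _ / N.
  have a_ge0 : 0 <= a by exact: powR_ge0.
  have s_ge0 : 0 <= s by rewrite divr_ge0 ?mulr_ge0 ?powR_ge0// ltW.
  have sp : s `^ p = A^-1 / N `^ p * a.
    rewrite powRM ?mulr_ge0 ?powR_ge0 ?invr_ge0 ?(ltW N_gt0)//.
    rewrite powRM ?powR_ge0// -powRrM mulNr mulVf ?lt0r_neq0//.
    rewrite powR_inv1 ?(ltW A_gt0)// -(powR_inv1 (ltW N_gt0)) -powRrM mulN1r.
    by rewrite powRN mulrAC.
  have rhs_ge0 : (0 <= (A^-1 / N `^ p * c0)%:E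
       * ((c2 * (a * Wp y))%:E + B%:E * Xi y))%E.
    rewrite mule_ge0 ?adde_ge0 ?mule_ge0 ?lee_fin ?(ltW k_gt0) ?(ltW B_gt0)//.
    by rewrite !mulr_ge0// ltW.
  (* If W(y) = 0 or f(y) = 0 the left side is 0; if Xi(y) = +oo the right side is +oo. Removing W(y)
     = 0 also keeps out the default value 0 of W(y)^(-1/p). *)
  have [Wy0|Wy0] := eqVneq (W y) 0; first by rewrite Wy0 mulr0.
  have Wy_gt0 : 0 < W y by rewrite lt0r Wy0 W_ge0.
  have [fy0|fy0] := eqVneq (f y) 0.
    rewrite (_ : `|s| = 0) ?powR0 ?lt0r_neq0 ?mulr0 ?mul0r//.
    by rewrite /s fy0 normr0 mulr0 mul0r normr0.
  have a_gt0 : 0 < a by rewrite powR_gt0// normr_gt0.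
  have [Xioo|Xioo] := eqVneq (Xi y) +oo%E.
    by rewrite Xioo gt0_muley ?lte_fin// addey// gt0_muley ?leey ?lte_fin.
  have Xi_lty : (Xi y < +oo)%E by rewrite ltey.
  have Xi_fin : Xi y = (fine (Xi y))%:E by rewrite fineK// ge0_fin_numE.
  pose D j : set (borel X) := ysection (U j) y.
  have mD j : measurable (D j) by exact: measurable_ysection_open.
  have mHy : measurable_fun [set: borel X] (fun x => H (x, y)).
    by move/measurable_EFinP : mH; exact: measurable_fun_pair1.
  pose XiD j := (\int[mu]_(x in D j) (H (x, y))%:E)%E.
  have XiD_le j : (XiD j <= Xi y)%E.
    apply: ge0_subset_integral => //.
    - exact/measurable_EFinP.
    - by move=> x _; rewrite lee_fin.
  pose bad j := ((W y * V j y * a)%:E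
    <= B%:E * \int[mu]_(x in D j) (`|f x - f y| `^ p * W x)%:E)%E.
  have badP j : bad j ->
      ((a * psi (V j.+1 y `^ (- p^-1)) * W y)%:E <= B%:E * XiD j)%E.
    move=> bad_j; set q := psi _; pose k := q / V j.+1 y.
    have q_ge0 : 0 <= q by rewrite psi_ge0 ?powR_ge0.
    have k_ge0 : 0 <= k by rewrite divr_ge0// ltW.
    (* Multiplying [bad j] by [k] leaves the ratio V_j / V_(j+1) on the left; it is at least 1 and
       is discarded. *)
    apply: (@le_trans _ _ ((W y * V j y * a * k)%:E)).
      rewrite lee_fin /k (_ : _ * (q / _) = a * q * W y * (V j y / V j.+1 y)).
        by rewrite ler_peMr ?mulr_ge0// ler_pdivlMr// mul1r star_decreasing.
      by field; rewrite gt_eqF.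
    have k_ge0' : (0 <= k%:E)%E by rewrite lee_fin.
    rewrite EFinM (le_trans (lee_wpmul2r k_ge0' bad_j))// -muleA.
    rewrite lee_wpmul2l ?lee_fin ?(ltW B_gt0)// muleC -ge0_integralZl//; last 2 first.
    - apply/measurable_EFinP; apply: measurable_funM; last exact: measurable_funTS.
      apply: (measurableT_comp (measurable_powR p)).
      apply: measurableT_comp => //; apply: measurable_funB => //.
      exact: measurable_funTS.
    - by move=> x _; rewrite lee_fin mulr_ge0 ?powR_ge0.
    apply: ge0_le_integral_nomeas => x Dx.
      by rewrite mule_ge0// lee_fin mulr_ge0 ?powR_ge0.
    rewrite -EFinM lee_fin mulrA /H indicE mem_set; last first.
      by apply: (U_decreasing U_nested (leq0n j)); exact/ysectionP.
    by rewrite mul1r ler_wpM2r// mulrC; exact: integrand_ge.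
  have goodP j : ~~ bad j -> W y * V j y * a <= B * (M * N `^ p).
    have := @mean_dichotomy _ _ _ mu (D j) f W p (f y) (W y) (V j y) c3 (mD j)
      (measurable_funTS mf) (measurable_funTS W_meas) W_ge0 (ltW p0)
      (ltW c3_gt0) (W_mean' y j).
    case=> [h _|h /negP[]//].
    rewrite -lee_fin (le_trans h)// [leRHS]EFinM lee_wpmul2l ?lee_fin ?(ltW B_gt0)//.
    apply: le_trans fW; apply: ge0_subset_integral => //; first exact: mpow.
    by move=> x _; rewrite lee_fin mulr_ge0.
  have ex_good : exists j, ~~ bad j.
    apply: contrapT => nex.
    have all_bad j : bad j by apply/negPn/negP => bj; apply: nex; exists j.
    (* [badP] with [psi] replaced by its minimum [psi 0] gives this lower bound for [XiD j], uniform
       in [j]. *)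
    pose e := B^-1 * (a * psi 0 * W y).
    have e_gt0 : 0 < e by rewrite !mulr_gt0 ?invr_gt0.
    have e_le j : (e%:E <= XiD j)%E.
      rewrite EFinM lee_pdivrMl// (le_trans _ (badP _ (all_bad j)))// lee_fin.
      by rewrite ler_wpM2r// ler_wpM2l// psi_nd// powR_ge0.
    have XiD0 : XiD j @[j --> \oo] --> 0%E.
      apply: cvg_integral_decreasing => //.
      - move=> m n mn; apply/subsetPset; apply: le_ysection.
        exact: U_decreasing.
      - move=> x Dx; have : (\bigcap_j U j) (x, y).
          by move=> j _; exact/ysectionP/Dx.
        rewrite U_diag /diagonal /= => ->.
        by rewrite /H /integrand /= subrr normr0 powR0 ?lt0r_neq0// mul0r mulr0 mul0r.
    have : (e%:E <= lim (XiD j @[j --> \oo]))%E.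
      by apply: lime_ge; [exact: cvgP XiD0|exact: nearW].
    by rewrite (cvg_lim _ XiD0)// lee_fin leNgt e_gt0.
  have [j good_j j_min] := ex_minnP ex_good.
  have psi_s : psi s
      <= c0 * (psi (V j y `^ (- p^-1)) + psit (W y `^ (- p^-1))).
    apply: (growth_le psi_nd psi_mul' p0) => //.
    (* By [goodP], s^p V_j(y) W(y) is at most B M / A <= 1. *)
    have Np_gt0 : 0 < N `^ p by rewrite powR_gt0.
    rewrite sp (_ : _ * _ = (W y * V j y * a / N `^ p) / A); last first.
      by field; rewrite !gt_eqF.
    rewrite ler_pdivrMr// mul1r ler_pdivrMr//.
    rewrite (le_trans (goodP _ good_j))// mulrA ler_wpM2r ?(ltW Np_gt0)//.
    by rewrite lerDl mulr_ge0 ?addr_ge0 ?mulr_ge0// ltW.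
  have level : a * (W y * (psi (V j y `^ (- p^-1)) + psit (W y `^ (- p^-1))))
      <= c2 * (a * Wp y) + B * fine (Xi y).
    have BXi_ge0 : 0 <= B * fine (Xi y) by rewrite mulr_ge0 ?fine_ge0// ltW.
    rewrite [c2 * _]mulrCA.
    (* The indices match: [badP] at the predecessor [j] controls [psi] at the volume of level
       [j.+1], the one that [psi_s] produces there. The [psit] term is always controlled by [Wp]. *)
    case: j good_j j_min {psi_s} => [_ _|j _ j_min].
      by rewrite -[leLHS]addr0 lerD// ler_wpM2l.
    have /badP bad_j : bad j.
      by apply/negPn/negP => /j_min; rewrite ltnn.
    rewrite !mulrDr addrC; apply: lerD.
      rewrite ler_wpM2l// (le_trans _ (W_Wp' y))// ler_wpM2l// lerDr.
      by rewrite psi_ge0 ?powR_ge0.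
    rewrite mulrCA mulrC -lee_fin (le_trans bad_j)// [leRHS]EFinM -Xi_fin.
    by rewrite lee_wpmul2l ?lee_fin ?(ltW B_gt0).
  rewrite Xi_fin ger0_norm// sp -!EFinM lee_fin.
  have K_ge0 : 0 <= A^-1 / N `^ p.
    by rewrite divr_ge0 ?invr_ge0 ?powR_ge0// ltW.
  rewrite -[leRHS]mulrA mulrCA -mulrA ler_wpM2l//.
  rewrite (le_trans _ (ler_wpM2l (ltW c0_gt0) level))//.
  rewrite (mulrC (psi s)) -mulrA (mulrCA c0) ler_wpM2l//.
  by rewrite mulrC (mulrCA c0) ler_wpM2l.

(* Integration of the pointwise bound *)
have s_ge0 y : 0 <= A `^ (- p^-1) * `|f y| / N.
  by rewrite divr_ge0 ?mulr_ge0 ?powR_ge0// ltW.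
have c2fWp y : (0 <= (c2 * (`|f y| `^ p * Wp y))%:E)%E.
  by rewrite lee_fin !mulr_ge0 ?powR_ge0 ?(ltW c2_gt0)//.
have BXi y : (0 <= B%:E * Xi y)%E by rewrite mule_ge0// lee_fin ltW.
have mc2fWp : measurable_fun [set: borel X]
    (fun y => (c2 * (`|f y| `^ p * Wp y))%:E).
  under eq_fun do rewrite EFinM.
  by apply: measurable_funeM; exact: mpow.
have mBXi : measurable_fun [set: borel X] (fun y => B%:E * Xi y)%E.
  exact: measurable_funeM.
apply: (@le_trans _ _ (\int[mu]_y ((A^-1 / N `^ p * c0)%:E
    * ((c2 * (`|f y| `^ p * Wp y))%:E + B%:E * Xi y)))%E).
  apply: ge0_le_integral_nomeas => y _; last exact: pt.
  by rewrite lee_fin !mulr_ge0 ?psi_ge0 ?powR_ge0.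
rewrite ge0_integralZl ?lee_fin ?(ltW k_gt0)//; last 2 first.
- exact: emeasurable_funD.
- by move=> y _; rewrite adde_ge0.
rewrite ge0_integralD//.
under eq_integral do rewrite EFinM.
rewrite !ge0_integralZl ?lee_fin ?(ltW c2_gt0) ?(ltW B_gt0)//; last 2 first.
- exact: mpow.
- by move=> y _; rewrite lee_fin mulr_ge0 ?powR_ge0.
rewrite XiE.
apply: (@le_trans _ _ ((A^-1 / N `^ p * c0)%:E
  * (c2%:E * (c1 * N `^ p)%:E + B%:E * (N `^ p)%:E))%E).
  rewrite lee_wpmul2l ?lee_fin ?(ltW k_gt0)// leeD2r// lee_wpmul2l//.
  by rewrite lee_fin ltW.
rewrite -!EFinM lee_fin.
have -> : A^-1 / N `^ p * c0 * (c2 * (c1 * N `^ p) + B * N `^ p)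
    = A^-1 * (c0 * (c2 * c1 + B)).
  by field; rewrite !gt_eqF ?powR_gt0.
by rewrite [leLHS]mulrC ler_pdivrMr// mul1r lerDr mulr_ge0 ?ltW.
Qed.
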